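(* Let $g:\mathbb R\to\mathbb R$ be a positive increasing function. Then in the unbounded forecasting game Reality strongly complies with the event $$\sum_n\frac{v_n}{g(A_n)}=\infty\ \Rightarrow\ \frac{\sum_{k\le n}(x_k-m_k)}{\sqrt{g(A_n)}}\ \text{ does not converge (as } n\to\infty),$$ where $A_n=\sum_{k=1}^n v_k$.
   Context: Unbounded forecasting game: $\mathcal K_0=1$. For $n=1,2,\ldots$: Forecaster announces $m_n\in\mathbb R$ and $v_n>0$; Skeptic announces $M_n\in\mathbb R$ and $V_n\ge0$; Reality announces $x_n\in\mathbb R$; and $\mathcal K_n:=\mathcal K_{n-1}+M_n(x_n-m_n)+V_n((x_n-m_n)^2-v_n)$. All moves are public. Skeptic's collateral duty is to keep $\mathcal K_n$ non-negative; Forecaster has no duty other than making allowed moves. A path is an infinite sequence $\xi=(m_1,v_1,x_1,m_2,v_2,x_2,\ldots)$ of allowed moves of Forecaster and Reality; $\Xi$ is the set of paths; an event is any subset of $\Xi$. For events, $E_1\Rightarrow E_2$ denotes $E_1^c\cup E_2$. ''Converges'' means converges to a finite real limit. Write $\mu_n=(m_n,v_n)$ and $\mathfrak m_n=(M_n,V_n)$. A (deterministic) strategy of Reality is a sequence $\mathcal R=\{\mathcal R_n\}_{n\ge1}$ of functions with $x_n=\mathcal R_n(\mu_1,\mathfrak m_1,\ldots,\mu_n,\mathfrak m_n)$. By $\mathcal R$ Reality strongly complies with an event $E$ if, irrespective of the moves $\mu_n,\mathfrak m_n$, $n\ge1$, of Forecaster and Skeptic, both observing their collateral duties, when Reality plays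 $\mathcal R$: (i) the resulting path $(\mu_1,x_1,\mu_2,x_2,\ldots)$ belongs to $E$, and (ii) $\mathcal K_n\le1=\mathcal K_0$ for all $n$. Reality strongly complies with $E$ if such an $\mathcal R$ exists. *)

(* Defs.v *)
(* Rounds are numbered from 0: the game's round n + 1 has
   index n, while [capital _ _ _ n] is K_n, the capital after n rounds. *)
From mathcomp Require Import all_boot all_order all_algebra.
From mathcomp Require Import all_classical all_reals all_analysis.
Set Implicit Arguments.
Unset Strict Implicit.
Unset Printing Implicit Defensive.
Import Order.TTheory GRing.Theory Num.Theory.
Import numFieldNormedType.Exports.
Local Open Scope classical_set_scope.
Local Open Scope ring_scope.

Record forecast (R : realType) := Forecast {
  fmean : R;
  fvar : R;
  fvar_gt0 : 0 < fvar }.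

Record stake (R : realType) := Stake {
  lin_stake : R;
  quad_stake : R;
  quad_stake_ge0 : 0 <= quad_stake }.

(* The moves of Forecaster and Reality; every path consists of allowed moves
   by typing, so that complements of events are taken in the set of paths. *)
Definition game_path (R : realType) := nat -> forecast R * R.

Definition event (R : realType) := set (game_path R).

Definition event_imp (R : realType) (E1 E2 : event R) : event R :=
  ~` E1 `|` E2.

Fixpoint capital (R : realType) (mu : nat -> forecast R) (s : nat -> stake R)
    (x : nat -> R) (n : nat) : R :=
  if n is k.+1 then
    capital mu s x k + lin_stake (s k) * (x k - fmean (mu k))
      + quad_stake (s k) * ((x k - fmean (mu k)) ^+ 2 - fvar (mu k))
  else 1.

(* A function of the finite history, whose length determines the round. *)
Definition reality_strategy (R : realType) :=
  seq (forecast R * stake R) -> R.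

Definition play (R : realType) (strat : reality_strategy R)
    (mu : nat -> forecast R) (s : nat -> stake R) (n : nat) : R :=
  strat (mkseq (fun i => (mu i, s i)) n.+1).

(* Skeptic's duty is imposed only along the play that is actually realized. *)
Definition strongly_complies_by (R : realType) (strat : reality_strategy R)
    (E : event R) : Prop :=
  forall (mu : nat -> forecast R) (s : nat -> stake R),
    let x := play strat mu s in
    (forall n, 0 <= capital mu s x n) ->
    E (fun n => (mu n, x n)) /\ (forall n, capital mu s x n <= 1).

Definition strongly_complies (R : realType) (E : event R) : Prop :=
  exists strat : reality_strategy R, strongly_complies_by strat E.

Definition path_mean (R : realType) (xi : game_path R) (n : nat) : R :=
  fmean (xi n).1.

Definition path_var (R : realType) (xi : game_path R) (n : nat) : R :=
  fvar (xi n).1.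

Definition path_outcome (R : realType) (xi : game_path R) (n : nat) : R :=
  (xi n).2.

(* With the shifted index, [cumul_var xi n] is A_(n + 1). *)
Definition cumul_var (R : realType) (xi : game_path R) (n : nat) : R :=
  \sum_(k < n.+1) path_var xi k.

Definition cumul_dev (R : realType) (xi : game_path R) (n : nat) : R :=
  \sum_(k < n.+1) (path_outcome xi k - path_mean xi k).

Definition var_series_diverges (R : realType) (g : R -> R) : event R :=
  [set xi | (\sum_(0 <= n <oo) (path_var xi n / g (cumul_var xi n))%:E
             = +oo)%E].

Definition normalized_dev_diverges (R : realType) (g : R -> R) : event R :=
  [set xi | ~ cvgn (fun n : nat =>
              cumul_dev xi n / Num.sqrt (g (cumul_var xi n)))].

(* Main.v *)
Require Import Defs.
From mathcomp Require Import all_boot all_order all_algebra.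
From mathcomp Require Import all_classical all_reals all_analysis.
From mathcomp Require Import ring lra.
Import Order.TTheory GRing.Theory Num.Theory.
Import numFieldNormedType.Exports.
Local Open Scope classical_set_scope.
Local Open Scope ring_scope.
Set Implicit Arguments.
Unset Strict Implicit.

(** Reality only uses the deviations x_n - m_n in {0, a, -a} with
    a ^ 2 = max (g (A_n)) v_n.  Put p = v_n / a ^ 2, a number in (0, 1].  Under
    the distribution that gives each of a and -a the probability p / 2, the
    deviation has mean 0 and variance v_n, so every stake of Skeptic has
    expected gain 0.  The sum of the p diverges together with the sum of the
    v_n / g (A_n), so a random Reality would jump up infinitely often and down
    infinitely often.  Since a jump has size at least sqrt (g (A_n)) and the
    normalization is nondecreasing, jumps in both directions prevent
    convergence: renormalizing the old sum only pulls the quotient towards 0, and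
    a jump against the sign of the limit then moves it by at least 1 in the wrong
    direction ([no_cvg_of_down_jumps]).

    The random Reality is made deterministic by a potential Q = u + w.  Both
    weights grow by the factor 1 + p / 4 in each round; u is halved by each jump
    up and w by each jump down.  Q is a positive supermartingale, and if it is
    bounded while the sum of the p diverges, there are infinitely many jumps of
    both kinds ([bounded_weight_summable]).  To bound Q without ever letting
    Skeptic's capital exceed 1, Reality uses the slack b = 1 - K.  As long as
    b = 0, Reality makes b positive if the stake permits it; otherwise all
    deviations leave the capital unchanged and one of them does not increase Q.
    Once b > 0, averaging shows that some deviation does not increase Q / b
    ([acceptable_exists]), which also keeps b positive.  Because Skeptic keeps K
    nonnegative, b <= 1, hence Q stays bounded. *)

(** * One round: the choice of a deviation *)

Section Round.
Variable R : realType.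
Implicit Types b u w M V v h d : R.

Definition gain M V v d : R := M * d + V * (d ^+ 2 - v).

(** The squared jump size [h] is kept apart from its root, because the
    probability of a jump is [v / h]. *)
Definition up_weight u v h d : R :=
  u * (1 + v / h / 4) * (if d == Num.sqrt h then 2^-1 else 1).

Definition down_weight w v h d : R :=
  w * (1 + v / h / 4) * (if d == - Num.sqrt h then 2^-1 else 1).

(** For a positive slack [b] the test is Q' / b' <= Q / b, multiplied out: in
    this form it is affine in the gain, so it can be averaged over the three
    deviations, and since Q' is positive it forces b' to be positive.  For
    [b = 0] the ratio makes no sense, and either the slack becomes positive or
    nothing gets worse. *)
Definition acceptable b u w M V v h d : bool :=
  let b' := b - gain M V v d in
  let Q' := up_weight u v h d + down_weight w v h d in
  if 0 < b then Q' * b <= (u + w) * b'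
  else (0 < b') || (b' == 0) && (Q' <= u + w).

Definition deviation b u w M V v h : R :=
  if acceptable b u w M V v h 0 then 0
  else if acceptable b u w M V v h (Num.sqrt h) then Num.sqrt h
  else - Num.sqrt h.

Lemma average_le0 (p F0 F1 F2 : R) : 0 < p -> p <= 1 ->
  (1 - p) * F0 + p / 2 * (F1 + F2) <= 0 ->
  [|| F0 <= 0, F1 <= 0 | F2 <= 0].
Proof.
move=> p0 p1 H; case: (lerP F0 0) => //= h0; case: (lerP F1 0) => //= h1.
case: (lerP F2 0) => //= h2.
have : 0 <= (1 - p) * F0 by apply: mulr_ge0; lra.
have : 0 < p / 2 * (F1 + F2) by apply: mulr_gt0; lra.
lra.
Qed.

(** Under the three-point distribution the gain has mean 0 and the potential
    is multiplied by at most (1 + p / 4) (1 - p / 4) < 1 on average.  So some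
    deviation does no worse than the average when the slack is positive or the
    stake is null; a nonzero stake always leaves a deviation with negative gain. *)
Lemma acceptable_exists b u w M V v h :
  0 <= b -> 0 < u -> 0 < w -> 0 <= V -> 0 < v -> v <= h ->
  acceptable b u w M V v h (deviation b u w M V v h).
Proof.
move=> b0 u0 w0 V0 v0 vh; rewrite /deviation.
case: ifPn => // n0; case: ifPn => // n1.
have h0 : 0 < h by lra.
set a := Num.sqrt h in n1 *.
have a0 : 0 < a by rewrite sqrtr_gt0.
have a2 : a ^+ 2 = h by rewrite sqr_sqrtr // ltW.
set p := v / h.
have p0 : 0 < p by rewrite divr_gt0.
have p1 : p <= 1 by rewrite ler_pdivrMr // mul1r.
have vE : v = p * a ^+ 2 by rewrite a2 /p divfK // gt_eqF.
have e1 : (0 == a) = false by rewrite lt_eqF.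
have e2 : (0 == - a) = false by rewrite gt_eqF // oppr_lt0.
have e3 : (a == - a) = false by rewrite gt_eqF // ; lra.
have e4 : (- a == a) = false by rewrite lt_eqF // ; lra.
move: n0 n1; rewrite /acceptable /gain /up_weight /down_weight -/p -/a.
rewrite !eqxx e1 e2 e3 e4 sqrrN.
clearbody a p; case: ltP => bp.
  set l0 := (X in ~~ (X <= _)); set r0 := (X in ~~ (_ <= X)).
  move=> n0; set l1 := (X in ~~ (X <= _)); set r1 := (X in ~~ (_ <= X)).
  move=> n1; set l2 := (X in X <= _); set r2 := (X in _ <= X).
  have := @average_le0 p (l0 - r0) (l1 - r1) (l2 - r2) p0 p1.
  rewrite !subr_le0 (negbTE n0) (negbTE n1) /=; apply.
  have -> : (1 - p) * (l0 - r0) + p / 2 * (l1 - r1 + (l2 - r2))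
     = - (p ^+ 2 / 16 * ((u + w) * b)).
    by rewrite /l0 /r0 /l1 /r1 /l2 /r2 vE; field.
  rewrite oppr_le0; apply: mulr_ge0; first by rewrite divr_ge0 ?sqr_ge0.
  by apply: mulr_ge0; lra.
have {bp b0} -> : b = 0 by lra.
have := V0; rewrite le_eqVlt => /orP[/eqP <-|Vp]; last first.
  (* With a positive quadratic stake the deviation 0 already costs Skeptic. *)
  suff -> : 0 < 0 - (M * 0 + V * (0 ^+ 2 - v)) by [].
  have := mulr_gt0 Vp v0; rewrite expr0n /=; lra.
rewrite !mul0r !addr0 !mulr0 !sub0r !mulrN opprK oppr0 eqxx ltxx /= !mulr1.
rewrite oppr_gt0 oppr_eq0.
case: (ltrgtP M 0) => M0.
- by rewrite nmulr_rlt0 // a0.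
- by rewrite pmulr_rgt0 // a0.
rewrite M0 mul0r eqxx ltxx /= -!ltNge => n0 n1.
have q0 : 0 <= p * (u + w) by apply: mulr_ge0; lra.
nra.
Qed.

End Round.

(** * Series and sequences *)

Section Series.
Variable R : realType.

(** From the last halving on, the weight increases by u p / 4, which is at least
    a fixed positive multiple of p. *)
Lemma bounded_weight_summable (u p : nat -> R) (C : R) (N : nat) :
  (forall n, 0 <= p n) -> 0 < u N -> (forall n, (N <= n)%N -> u n <= C) ->
  (forall n, (N <= n)%N -> u n.+1 = u n * (1 + p n / 4)) ->
  exists B, forall n, \sum_(k < n) p k <= B.
Proof.
move=> p0 u0 uC uS.
have grow n : u N * (1 + (\sum_(i < n) p (N + i)%N) / 4) <= u (N + n)%N.
  elim: n => [|n IH]; first by rewrite big_ord0 mul0r addr0 mulr1 addn0.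
  rewrite addnS uS ?leq_addr // big_ord_recr /=.
  set S := \sum_(i < n) _ in IH *; set q := p _.
  have q0 : 0 <= q by exact: p0.
  have S0 : 0 <= S by apply: sumr_ge0.
  apply: (@le_trans _ _ (u N * (1 + S / 4) * (1 + q / 4))); last first.
    by apply: ler_wpM2r => //; lra.
  rewrite -mulrA ler_pM2l //.
  have := mulr_ge0 S0 q0; lra.
exists (\sum_(k < N) p k + 4 * (C / u N)) => n.
apply: (@le_trans _ _ (\sum_(k < N + n) p k)).
  rewrite [(N + n)%N]addnC big_split_ord /= lerDl; exact: sumr_ge0.
rewrite big_split_ord /= lerD2l.
have /ler_pM2l <- := u0; rewrite mulrCA [u N * (C / _)]mulrC divfK ?gt_eqF //.
have := grow n; have := uC _ (leq_addr n N); lra.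
Qed.

(** If the truncated ratios v / max (G, v) = min (v / G, 1) are summable, they
    tend to 0, so all but finitely many are not truncated. *)
Lemma truncated_sum_unbounded (v G : nat -> R) (B : R) :
  (forall n, 0 < v n) -> (forall n, 0 < G n) ->
  (\sum_(0 <= n <oo) (v n / G n)%:E = +oo)%E ->
  ~ forall n, \sum_(k < n) v k / Num.max (G k) (v k) <= B.
Proof.
move=> v0 G0 dvg bnd.
pose p n := v n / Num.max (G n) (v n).
have m0 n : 0 < Num.max (G n) (v n) by rewrite lt_max G0.
have p0 n : 0 <= p n by rewrite divr_ge0 // ltW.
have r0 n : 0 <= v n / G n by rewrite divr_ge0 // ltW.
have cp : cvgn (series p).
  apply: nondecreasing_is_cvgn.
    apply/nondecreasing_seqP => n.
    by rewrite /series /= big_nat_recr //= lerDl.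
  by exists B => _ [n _ <-]; rewrite /series /= big_mkord; exact: bnd.
have /cvgrPdist_lt /(_ 1 ltr01) [N _ HN] := cvg_series_cvg_0 cp.
have pE n : (N <= n)%N -> v n / G n = p n.
  move=> /HN /=; rewrite sub0r normrN ger0_norm // /p.
  case: (lerP (v n) (G n)) => [//|lt_Gv].
  by rewrite divff ?ltxx // gt_eqF.
pose C := \sum_(k < N) v k / G k + B.
have part n : \sum_(k < n) v k / G k <= C.
  apply: (@le_trans _ _ (\sum_(k < N + n) v k / G k)).
    rewrite [(N + n)%N]addnC big_split_ord /= lerDl; exact: sumr_ge0.
  rewrite big_split_ord /= lerD2l.
  apply: le_trans (bnd (N + n)%N); rewrite big_split_ord /=.
  rewrite (eq_bigr (fun i : 'I_n => p (N + i)%N)) => [|i _].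
    by rewrite lerDr; apply: sumr_ge0 => i _; exact: p0.
  by rewrite pE // leq_addr.
suff : (\sum_(0 <= n <oo) (v n / G n)%:E <= C%:E)%E by rewrite dvg.
apply: lime_le.
  by apply: is_cvg_nneseries => n _ _; rewrite lee_fin.
by apply: nearW => n; rewrite sumEFin lee_fin big_mkord.
Qed.

(** Near the limit l >= 0, the quotient t' after a jump exceeds l - 1/2 and the
    quotient t before it is below l + 1/2.  Renormalizing the old sum by the
    larger root only moves t towards 0, so it stays below l + 1/2.  The jump
    would therefore be larger than -1 in units of the new root. *)
Lemma no_cvg_of_down_jumps (S G : nat -> R) (l : R) :
  (forall n, 0 < G n) -> (forall n, G n <= G n.+1) -> 0 <= l ->
  (forall N, exists2 n, (N <= n)%N &
    S n.+1 - S n <= - Num.sqrt (G n.+1)) ->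
  ~ (fun n => S n / Num.sqrt (G n)) @ \oo --> l.
Proof.
move=> G0 GS l0 jump /cvgrPdist_lt /(_ 2^-1).
rewrite invr_gt0 ltr0n => /(_ isT) [N _ HN].
have [n leNn Sn] := jump N.
have /= := HN n.+1 (leqW leNn); have /= := HN n leNn.
have s0 k : 0 < Num.sqrt (G k) by rewrite sqrtr_gt0.
have sS : Num.sqrt (G n) <= Num.sqrt (G n.+1) by rewrite ler_sqrt // ltW.
have e k : S k = S k / Num.sqrt (G k) * Num.sqrt (G k).
  by rewrite divfK // gt_eqF.
move: Sn; rewrite {1}[S n]e {1}[S n.+1]e.
move: (S n / _) (S n.+1 / _) sS (s0 n) (s0 n.+1) => t t'.
move: (Num.sqrt (G n)) (Num.sqrt (G n.+1)) => a a' le_aa' a0 a'0 Sn.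
rewrite !ltr_norml => /andP[lt_t _] /andP[_ lt_t'].
have lt_ta : t * a < (l + 2^-1) * a'.
  apply: (@le_lt_trans _ _ (Num.max 0 t * a')).
    have [t0|t0] := lerP t 0; first by rewrite mul0r; nra.
    by rewrite ler_pM2l.
  by rewrite ltr_pM2r // gt_max; apply/andP; split; lra.
have : (l - 2^-1) * a' < t' * a' by rewrite ltr_pM2r //; lra.
lra.
Qed.

End Series.

(** * The strategy and its play *)

Section Strategy.
Variables (R : realType) (g : R -> R).
Hypothesis g_gt0 : forall t : R, 0 < g t.

(** What Reality remembers of the history; [outcome] is its latest move, which
    lets the strategy be a fold over the history. *)
Record ledger := Ledger {
  up : R;
  down : R;
  slack : R;
  elapsed : R;
  outcome : R }.

(** The maximum with [v] keeps the probability [v / jump_sq A v] at most 1. *)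
Definition jump_sq (A v : R) : R := Num.max (g (A + v)) v.

Definition step (L : ledger) (r : forecast R * stake R) : ledger :=
  let v := fvar r.1 in
  let h := jump_sq (elapsed L) v in
  let M := lin_stake r.2 in
  let V := quad_stake r.2 in
  let d := deviation (slack L) (up L) (down L) M V v h in
  Ledger (up_weight (up L) v h d) (down_weight (down L) v h d)
    (slack L - gain M V v d) (elapsed L + v) (fmean r.1 + d).

Definition start : ledger := Ledger 1 1 0 0 0.

Definition strategy : reality_strategy R :=
  fun h => outcome (foldl step start h).

Variables (mu : nat -> forecast R) (s : nat -> stake R).

Let x := play strategy mu s.

Definition ledger_at (n : nat) : ledger :=
  foldl step start (mkseq (fun i => (mu i, s i)) n).

Local Notation L := ledger_at.

Lemma ledger_atS n : L n.+1 = step (L n) (mu n, s n).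
Proof. by rewrite /ledger_at mkseqS foldl_rcons. Qed.

Lemma outcome_at n : x n = outcome (L n.+1).
Proof. by []. Qed.

Lemma elapsed_at n : elapsed (L n) = \sum_(k < n) fvar (mu k).
Proof.
elim: n => [|n IH]; first by rewrite big_ord0.
by rewrite ledger_atS big_ord_recr /= IH.
Qed.

Lemma slack_at n : slack (L n) = 1 - capital mu s x n.
Proof.
elim: n => [|n IH] /=; first by rewrite subrr.
rewrite outcome_at ledger_atS /= IH /gain; ring.
Qed.

Let h n := jump_sq (elapsed (L n)) (fvar (mu n)).
Let p n := fvar (mu n) / h n.
Let d n := x n - fmean (mu n).
Let potential n := up (L n) + down (L n).

Lemma jump_sq_gt0 n : 0 < h n.
Proof. by rewrite /h /jump_sq lt_max g_gt0. Qed.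

Lemma jump_prob_gt0 n : 0 < p n.
Proof. by rewrite divr_gt0 ?fvar_gt0 ?jump_sq_gt0. Qed.

Lemma deviation_at n : d n = deviation (slack (L n)) (up (L n)) (down (L n))
  (lin_stake (s n)) (quad_stake (s n)) (fvar (mu n)) (h n).
Proof. by rewrite /d outcome_at ledger_atS /= addrC addKr. Qed.

Lemma up_atS n : up (L n.+1) =
  up (L n) * (1 + p n / 4) * (if d n == Num.sqrt (h n) then 2^-1 else 1).
Proof. by rewrite ledger_atS /= -deviation_at. Qed.

Lemma down_atS n : down (L n.+1) =
  down (L n) * (1 + p n / 4) * (if d n == - Num.sqrt (h n) then 2^-1 else 1).
Proof. by rewrite ledger_atS /= -deviation_at. Qed.

Lemma up_gt0 n : 0 < up (L n).
Proof.
elim: n => [|n IH]; first exact: ltr01.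
rewrite up_atS !mulr_gt0 //; first by have := jump_prob_gt0 n; lra.
by case: ifP => // _; rewrite invr_gt0.
Qed.

Lemma down_gt0 n : 0 < down (L n).
Proof.
elim: n => [|n IH]; first exact: ltr01.
rewrite down_atS !mulr_gt0 //; first by have := jump_prob_gt0 n; lra.
by case: ifP => // _; rewrite invr_gt0.
Qed.

Lemma potential_gt0 n : 0 < potential n.
Proof. by rewrite addr_gt0 ?up_gt0 ?down_gt0. Qed.

Lemma slack_step n : 0 <= slack (L n) ->
  if 0 < slack (L n) then
    potential n.+1 * slack (L n) <= potential n * slack (L n.+1)
  else (0 < slack (L n.+1)) ||
    (slack (L n.+1) == 0) && (potential n.+1 <= potential n).
Proof.
move=> b0; rewrite /potential ledger_atS /=.
apply: (@acceptable_exists R (slack (L n)) (up (L n)) (down (L n))) => //.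
- exact: up_gt0.
- exact: down_gt0.
- exact: quad_stake_ge0.
- exact: fvar_gt0.
- by rewrite /jump_sq le_max lexx orbT.
Qed.

Lemma slackS_gt0 n : 0 < slack (L n) -> 0 < slack (L n.+1).
Proof.
move=> b0; have := slack_step (ltW b0); rewrite b0 => H.
have := lt_le_trans (mulr_gt0 (potential_gt0 n.+1) b0) H.
by rewrite pmulr_rgt0 ?potential_gt0.
Qed.

Lemma slack_ge0 n : 0 <= slack (L n).
Proof.
elim: n => [|n IH]; first exact: lexx.
move: (IH); rewrite le_eqVlt => /orP[/eqP b0|/slackS_gt0/ltW //].
have := slack_step IH; rewrite -b0 ltxx.
by move=> /orP[/ltW //|/andP[/eqP -> _]].
Qed.

Lemma capital_le1 n : capital mu s x n <= 1.
Proof. by have := slack_ge0 n; rewrite slack_at subr_ge0. Qed.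

Lemma potential_slack_le N n : 0 < slack (L N) ->
  0 < slack (L (N + n)%N) /\
  potential (N + n)%N * slack (L N) <= potential N * slack (L (N + n)%N).
Proof.
move=> b0; elim: n => [|n [bn IH]]; first by rewrite addn0.
have b'0 := slackS_gt0 bn; have H := slack_step (ltW bn).
rewrite bn in H; rewrite addnS; split => //.
rewrite -(ler_pM2r bn) mulrAC.
apply: le_trans (ler_wpM2r (ltW b0) H) _.
by rewrite mulrAC [leRHS]mulrAC ler_pM2r.
Qed.

(** While the slack is 0 the potential does not increase; once it is positive,
    the potential is at most a constant times the slack, which is at most 1
    because the capital is nonnegative. *)
Lemma potential_bounded : (forall n, 0 <= capital mu s x n) ->
  exists C N, forall n, (N <= n)%N -> potential n <= C.
Proof.
move=> K0; case: (pselect (exists N, 0 < slack (L N))) => [[N b0]|nb].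
  exists (potential N / slack (L N)), N => n /subnKC <-.
  have [_ H] := potential_slack_le (n - N) b0.
  rewrite ler_pdivlMr //; apply: le_trans H _.
  rewrite ger_pMr ?potential_gt0 // slack_at.
  by have := K0 (N + (n - N))%N; lra.
have z n : (0 < slack (L n)) = false by apply/negP => b; apply: nb; exists n.
exists (potential 0%N), 0%N; elim=> [//|n IH] _.
apply: le_trans (IH (leq0n n)).
by have := slack_step (slack_ge0 n); rewrite !z /= => /andP[].
Qed.

Hypothesis K0 : forall n, 0 <= capital mu s x n.
Hypothesis dvg : (\sum_(0 <= n <oo)
  (fvar (mu n) / g (\sum_(k < n.+1) fvar (mu k)))%:E = +oo)%E.

Lemma jump_prob_unbounded B : ~ forall n, \sum_(k < n) p k <= B.
Proof.
have := @truncated_sum_unbounded R (fun n => fvar (mu n))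
  (fun n => g (\sum_(k < n.+1) fvar (mu k))) B.
move=> /(_ (fun n => fvar_gt0 _) (fun n => g_gt0 _) dvg) H bnd.
apply: H => n; apply: le_trans (bnd n); rewrite le_eqVlt; apply/orP; left.
apply/eqP/eq_bigr => k _.
by rewrite /p /h /jump_sq elapsed_at big_ord_recr.
Qed.

(** Without jumps up from some round on, the weight that only such jumps reduce
    would grow beyond any bound on the potential. *)
Lemma up_jumps N : exists2 n, (N <= n)%N & d n = Num.sqrt (h n).
Proof.
have [C [N' HC]] := potential_bounded K0; apply: contrapT => no.
have [||||B] := @bounded_weight_summable R (up \o L) p C (maxn N N').
- by move=> n; exact/ltW/jump_prob_gt0.
- exact: up_gt0.
- move=> n; rewrite geq_max => /andP[_ /HC]; apply: le_trans.
  by rewrite lerDl ltW ?down_gt0.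
- move=> n; rewrite geq_max => /andP[leNn _] /=; rewrite up_atS.
  by case: eqP => [dn|_]; [case: no; exists n | rewrite mulr1].
- exact: jump_prob_unbounded.
Qed.

Lemma down_jumps N : exists2 n, (N <= n)%N & d n = - Num.sqrt (h n).
Proof.
have [C [N' HC]] := potential_bounded K0; apply: contrapT => no.
have [||||B] := @bounded_weight_summable R (down \o L) p C (maxn N N').
- by move=> n; exact/ltW/jump_prob_gt0.
- exact: down_gt0.
- move=> n; rewrite geq_max => /andP[_ /HC]; apply: le_trans.
  by rewrite lerDr ltW ?up_gt0.
- move=> n; rewrite geq_max => /andP[leNn _] /=; rewrite down_atS.
  by case: eqP => [dn|_]; [case: no; exists n | rewrite mulr1].
- exact: jump_prob_unbounded.
Qed.

Lemma jump_size n :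
  Num.sqrt (g (\sum_(k < n.+1) fvar (mu k))) <= Num.sqrt (h n).
Proof.
apply: ler_wsqrtr.
by rewrite /h /jump_sq elapsed_at big_ord_recr le_max lexx.
Qed.

Hypothesis g_incr : {homo g : a b / a <= b}.

(** The jumps that contradict a limit are those against its sign; a negative
    limit is reduced to a positive one by changing all signs. *)
Lemma normalized_dev_not_cvg :
  ~ cvgn (fun n => (\sum_(k < n.+1) d k) /
                   Num.sqrt (g (\sum_(k < n.+1) fvar (mu k)))).
Proof.
set S := fun n => \sum_(k < n.+1) d k.
pose G n := g (\sum_(k < n.+1) fvar (mu k)).
move=> /cvg_ex [l cl].
have GS n : G n <= G n.+1.
  by apply: g_incr; rewrite [leRHS]big_ord_recr lerDl ltW ?fvar_gt0.
have G0 n : 0 < G n by exact: g_gt0.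
have Sd n : S n.+1 - S n = d n.+1.
  by rewrite /S [X in X - _]big_ord_recr /= addrAC subrr add0r.
case: (lerP 0 l) => l0.
  (* The quotient with index n involves the rounds up to n, hence the shift. *)
  apply: (@no_cvg_of_down_jumps R S G l) => // N.
  have [[|n] // leNn dn] := down_jumps N.+1.
  by exists n => //; rewrite Sd dn lerN2 jump_size.
apply: (@no_cvg_of_down_jumps R (fun n => - S n) G (- l)) => //.
- by lra.
- move=> N; have [[|n] // leNn dn] := up_jumps N.+1.
  by exists n => //; rewrite -opprD Sd dn lerN2 jump_size.
under eq_fun do rewrite mulNr.
exact: cvgN.
Qed.

End Strategy.

Unset Implicit Arguments.

Theorem theorem4p12 (R : realType) (g : R -> R)
    (g_gt0 : forall t : R, 0 < g t)
    (g_incr : {homo g : s t / s <= t}) :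
  strongly_complies
    (event_imp (var_series_diverges g) (normalized_dev_diverges g)).
Proof.
exists (strategy g) => mu s x K0; split; last exact: capital_le1.
case: (pselect (var_series_diverges g (fun n => (mu n, x n)))) => dvg.
  by right; exact: (@normalized_dev_not_cvg R g g_gt0 mu s K0 dvg g_incr).
by left.
Qed.
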